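(* Let $k$ be an infinite field, let $S$ be a standard $\mathbb{N}^n$-graded $k$-algebra, and let $S^\Delta$ be its diagonal subring. Suppose that $d := \dim S^\Delta \geq 1$, and that $\{x_{ij} \mid 1\leq i \leq n,\ 1\leq j \leq d\}$ and $\{w_{ij} \mid 1\leq i \leq n,\ 1\leq j \leq d\}$ are complete reductions of $S$ (of type $d$). Then there is a proper Zariski-closed subset $M \subsetneq k^d$ such that for any $\mathbf{v} = \{v_j\} \in k^d$, we have $\mathbf{v} \notin M$ if and only if the $n \times d$ matrix $\{x^{\mathbf{v}}_{ij}\}$ is a complete reduction of $S$, where $$x^{\mathbf{v}}_{ij} := \begin{cases} x_{ij} & \text{if } j < d, \\ \sum_{h=1}^d v_h w_{ih} & \text{if } j = d. \end{cases}$$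
   Context: All rings are commutative with identity. For an $\mathbb{N}^n$-graded $k$-algebra $S$ and $1 \leq i \leq n$, write $S^{(i)} := S_{(0,\dotsc,0,1,0,\dotsc,0)}$, with the $1$ in the $i$th position. $S$ is called standard if $S_{(0,\dotsc,0)} = k$ and $S$ is generated as a $k$-algebra by $S^{(1)} \cup \cdots \cup S^{(n)}$. The diagonal subring of $S$ is $S^\Delta := k[S_{(1,1,\dotsc,1)}]$, the $k$-subalgebra generated by $S_{(1,\dotsc,1)}$, which is $\mathbb{N}$-graded by giving elements of $S_{(m,m,\dotsc,m)}$ degree $m$; $\dim$ denotes Krull dimension. A complete reduction of $S$ of type $r$ is an $n \times r$ matrix $\{x_{ij}\}$ with each $x_{ij} \in S^{(i)}$ such that, setting $X_j := \prod_{i=1}^n x_{ij}$ for $1 \leq j \leq r$, the ring $S^\Delta$ is module-finite over its subring $k[X_1,\dotsc,X_r]$. A Zariski-closed subset of $k^{d}$ is the common zero locus in $k^{d}$ of a set of polynomials over $k$ in the $d$ coordinates. *)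

(* Defs.v *)
From HB Require Import structures.
From mathcomp Require Import all_boot all_order all_algebra.
From mathcomp Require Import boolp classical_sets cardinality.
From mathcomp Require Import mpoly.

Set Implicit Arguments.
Unset Strict Implicit.
Unset Printing Implicit Defensive.

Import GRing.Theory.

Local Open Scope classical_set_scope.
Local Open Scope ring_scope.

Section GeneratedSubalgebra.
Variables (k : fieldType) (S : comAlgType k) (A : set S).

(* k[A] *)
Definition gen_subalg : set S :=
  smallest (fun B : set S => GRing.subalg_closed (mem B)) A.

Lemma gen_subalg_closed : GRing.subalg_closed (mem gen_subalg).
Proof.
split=> [|c u v /set_mem uA /set_mem vA|u v /set_mem uA /set_mem vA];
  apply/mem_set => B /= [clB AB]; have [B1 BZ BM] := clB; apply/set_mem.
- exact: B1.
- by apply: BZ; apply/mem_set; [apply: uA | apply: vA].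
- by apply: BM; apply/mem_set; [apply: uA | apply: vA].
Qed.

Definition gen_subalg_pred : {pred S} := mem gen_subalg.

HB.instance Definition _ :=
  GRing.isSubalgClosed.Build k S gen_subalg_pred gen_subalg_closed.

(* k[A] as a ring in its own right *)
Definition gen_subalg_type : Type := {x : S | x \in gen_subalg_pred}.

HB.instance Definition _ := SubChoice.on gen_subalg_type.
HB.instance Definition _ :=
  [SubChoice_isSubComNzRing of gen_subalg_type by <:].

End GeneratedSubalgebra.

Section KrullDimension.
Variable R : comNzRingType.

Definition prime_ideal (P : set R) : Prop :=
  idealr_closed (mem P) /\ prime_idealr_closed (mem P).

(* strictly increasing chains P_0 < ... < P_m of m + 1 prime ideals *)
Definition prime_chain (m : nat) (P : 'I_m.+1 -> set R) : Prop :=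
  (forall i, prime_ideal (P i)) /\
  (forall i j : 'I_m.+1, (i < j)%N -> P i `<` P j).

(* "dim R = d" (in particular dim R is finite) *)
Definition krull_dim (d : nat) : Prop :=
  (exists P : 'I_d.+1 -> set R, prime_chain P) /\
  (forall m (P : 'I_m.+1 -> set R), prime_chain P -> (m <= d)%N).

End KrullDimension.

(* The ring A is a finitely generated module over its subring B. *)
Definition module_finite (R : comNzRingType) (B A : set R) : Prop :=
  B `<=` A /\
  exists (m : nat) (a : 'I_m -> R),
    (forall l, A (a l)) /\
    (forall y, A y ->
       exists b : 'I_m -> R, (forall l, B (b l)) /\ y = \sum_l b l * a l).

Section Graded.
Variables (k : fieldType) (n : nat) (S : comAlgType k).

(* 'X_{1..n}, the library's type of exponents, serves as the monoid N^n; its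
   unit, addition and standard basis are 0%MM, (a + b)%MM and U_(i)%MM. *)
Implicit Type G : 'X_{1..n} -> set S.

(* S is the internal direct sum of the k-subspaces G a, and G a G b is
   contained in G (a + b). *)
Record graded_algebra G : Prop := GradedAlgebra {
  graded_subspace : forall a, GRing.submod_closed (mem (G a));
  graded_span : forall y : S, exists (s : seq 'X_{1..n}) (f : 'X_{1..n} -> S),
    (forall a, G a (f a)) /\ y = \sum_(a <- s) f a;
  graded_direct : forall (s : seq 'X_{1..n}) (f : 'X_{1..n} -> S),
    uniq s -> (forall a, G a (f a)) -> \sum_(a <- s) f a = 0 ->
    forall a, a \in s -> f a = 0;
  graded_mul : forall a b y z, G a y -> G b z -> G (a + b)%MM (y * z)
}.

Definition standard_graded G : Prop :=
  [/\ graded_algebra G,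
      G 0%MM = [set c%:A | c in [set: k]] &
      gen_subalg (\bigcup_(i in [set: 'I_n]) G U_(i)%MM) = [set: S]].

Definition diag G : set S := gen_subalg (G [multinom 1%N | _ < n]).

Definition diag_ring G : comNzRingType :=
  gen_subalg_type (G [multinom 1%N | _ < n]).

Definition complete_reduction G (r : nat) (x : 'M[S]_(n, r)) : Prop :=
  (forall i j, G U_(i)%MM (x i j)) /\
  module_finite (gen_subalg [set \prod_i x i j | j in [set: 'I_r]]) (diag G).

End Graded.

Definition zariski_closed (k : fieldType) (d : nat) (M : set 'rV[k]_d) : Prop :=
  exists I : set {mpoly k[d]},
    M = [set v | forall p : {mpoly k[d]}, I p -> p.@[v 0] = 0].

(* Main.v *)
Require Import Defs.
From mathcomp Require Import all_boot all_order all_algebra.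
From mathcomp Require Import boolp classical_sets cardinality.
From mathcomp Require Import mpoly.

(** Let A_m be the degree m part of S^Delta, X_j and W_j the column products of
    the two reductions, and a_v := \prod_i \sum_h v_h w_ih. By graded Nakayama, a
    family z in A_1 makes S^Delta finite over k[z] iff the ideal (z) contains all
    A_m with m large.

    This condition on (X_1, ..., X_{d-1}, a_v) is open in v: if it holds at v0,
    write a spanning family of A_{m+1} through these generators at v0; moving v
    multiplies the family by a square matrix polynomial in v, equal to 1 at v0,
    and where its determinant is nonzero the condition persists.

    For the existence of one such v, put I := (X_1, ..., X_{d-1}) and t := X_d. The
    degree 0 part of (S^Delta / I)[1/t] is a finite-dimensional algebra in which
    the a_v / t act by commuting matrices B(v), polynomial in v, and the condition
    holds as soon as B(v) is invertible. The matrices B(e_h), which represent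
    W_h / t, have no common kernel vector, because t^D lies in (W_1, ..., W_d). A v
    maximising the rank of a high power of B(v) then makes B(v) invertible. *)

Set Implicit Arguments.
Unset Strict Implicit.
Unset Printing Implicit Defensive.

Import GRing.Theory.

Local Open Scope classical_set_scope.
Local Open Scope ring_scope.

(** * Polynomial functions on affine space over an infinite field *)

Section PolynomialFunctions.
Variables (k : fieldType) (d : nat).
Implicit Types F H : 'rV[k]_d -> k.

Definition polyfun F : Prop := exists p : {mpoly k[d]}, forall v, F v = p.@[v 0].

Lemma polyfun_ext F H : F =1 H -> polyfun F -> polyfun H.
Proof. by move=> eFH [p Hp]; exists p => v; rewrite -eFH. Qed.

Lemma polyfun_const c : polyfun (fun=> c).
Proof. by exists c%:MP => v; rewrite mevalC. Qed.

Lemma polyfun_coord j : polyfun (fun v => v 0 j).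
Proof. by exists 'X_j => v; rewrite mevalXU. Qed.

Lemma polyfunD F H : polyfun F -> polyfun H -> polyfun (fun v => F v + H v).
Proof. by move=> [p Hp] [q Hq]; exists (p + q) => v; rewrite mevalD Hp Hq. Qed.

Lemma polyfunM F H : polyfun F -> polyfun H -> polyfun (fun v => F v * H v).
Proof. by move=> [p Hp] [q Hq]; exists (p * q) => v; rewrite mevalM Hp Hq. Qed.

Lemma polyfun_sum (I : Type) (r : seq I) (P : pred I) (F : I -> 'rV[k]_d -> k) :
  (forall i, polyfun (F i)) -> polyfun (fun v => \sum_(i <- r | P i) F i v).
Proof.
move=> HF; elim: r => [|i r IHr].
  by apply: (polyfun_ext _ (polyfun_const 0)) => v; rewrite big_nil.
apply: (@polyfun_ext (fun v => (if P i then F i v else 0)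
                               + \sum_(j <- r | P j) F j v)).
  by move=> v; rewrite big_cons; case: ifP; rewrite ?add0r.
by apply: polyfunD => //; case: (P i) => //; apply: (polyfun_const 0).
Qed.

Lemma polyfun_prod (I : Type) (r : seq I) (P : pred I) (F : I -> 'rV[k]_d -> k) :
  (forall i, polyfun (F i)) -> polyfun (fun v => \prod_(i <- r | P i) F i v).
Proof.
move=> HF; elim: r => [|i r IHr].
  by apply: (polyfun_ext _ (polyfun_const 1)) => v; rewrite big_nil.
apply: (@polyfun_ext (fun v => (if P i then F i v else 1)
                               * \prod_(j <- r | P j) F j v)).
  by move=> v; rewrite big_cons; case: ifP; rewrite ?mul1r.
by apply: polyfunM => //; case: (P i) => //; apply: (polyfun_const 1).
Qed.

Lemma polyfun_det e (B : 'rV[k]_d -> 'M[k]_e) :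
  (forall i j, polyfun (fun v => B v i j)) -> polyfun (fun v => \det (B v)).
Proof.
move=> HB; apply: polyfun_sum => s; apply: (polyfunM (polyfun_const _)).
exact: polyfun_prod.
Qed.

Lemma polyfun_mulmx e1 e2 e3
    (B : 'rV[k]_d -> 'M[k]_(e1, e2)) (C : 'rV[k]_d -> 'M[k]_(e2, e3)) :
  (forall i j, polyfun (fun v => B v i j)) ->
  (forall i j, polyfun (fun v => C v i j)) ->
  forall i j, polyfun (fun v => (B v *m C v) i j).
Proof.
move=> HB HC i j; apply: polyfun_ext; first by move=> v; rewrite mxE.
by apply: polyfun_sum => l; apply: polyfunM.
Qed.

Lemma polyfun_expmx e (B : 'rV[k]_d -> 'M[k]_e.+1) N :
  (forall i j, polyfun (fun v => B v i j)) ->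
  forall i j, polyfun (fun v => (B v ^+ N) i j).
Proof.
move=> HB; elim: N => [|N IHN] i j; first exact: polyfun_const.
apply: polyfun_ext; first by move=> v; rewrite exprS.
exact: polyfun_mulmx.
Qed.

Lemma polyfun_line F u v : polyfun F ->
  exists q : {poly k}, forall c, F (u + c *: v) = q.[c].
Proof.
move=> [p Hp].
exists (\sum_(m <- msupp p) (p@_m)%:P * \prod_i ((u 0 i)%:P + (v 0 i)%:P * 'X) ^+ m i).
move=> c; rewrite Hp mevalE horner_sum; apply: eq_bigr => m _.
rewrite hornerM hornerC horner_prod; congr (_ * _); apply: eq_bigr => i _.
by rewrite horner_exp !mxE !hornerE mulrC.
Qed.

Lemma infinite_nonroot (p : {poly k}) :
  infinite_set [set: k] -> p != 0 -> exists c, p.[c] != 0.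
Proof.
move=> kinf p0; apply: contrapT => H.
have [rs _] := infinite_set_fset (size p) kinf.
rewrite leqNgt (max_poly_roots p0) ?finmap.fset_uniq //.
by apply/allP => c _; apply/negPn/negP => Hc; apply: H; exists c.
Qed.

(* Restrict to the line through the two points. *)
Lemma polyfun_common_nonzero F H u v :
  infinite_set [set: k] -> polyfun F -> polyfun H -> F u != 0 -> H v != 0 ->
  exists w, F w != 0 /\ H w != 0.
Proof.
move=> kinf pF pH Fu Hv.
have [p Hp] := polyfun_line u (v - u) pF.
have [q Hq] := polyfun_line u (v - u) pH.
have p0 : p != 0.
  by apply: contraNneq Fu => p0; rewrite -[u]addr0 -(scale0r (v - u)) Hp p0 horner0.
have q0 : q != 0.
  apply: contraNneq Hv => q0.
  by rewrite -[v](subrK u) addrC -[v - u]scale1r Hq q0 horner0.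
have [c] := infinite_nonroot kinf (mulf_neq0 p0 q0).
rewrite hornerM mulf_eq0 negb_or -Hp -Hq => /andP[? ?].
by exists (u + c *: (v - u)).
Qed.

End PolynomialFunctions.

(** * Kernels and ranks in commuting families of matrices *)

Section CommutingMatrices.
Variable k : fieldType.

(* By Cayley-Hamilton, as the characteristic polynomial is 'X^m times a
   polynomial prime to 'X. *)
Lemma kermx_exp_stable e (B : 'M[k]_e.+1) (m : nat) (u : 'M[k]_(m, e.+1)) :
  u *m B ^+ e.+1 *m B ^+ e.+1 = 0 -> u *m B ^+ e.+1 = 0.
Proof.
move=> uB0; have [m0 [q q0 Epq]] := multiplicity_XsubC (char_poly B) 0.
have p0 : char_poly B != 0 by rewrite -size_poly_eq0 size_char_poly.
move: q0 Epq; rewrite p0 subr0 /= => q0 Epq.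
have qn0 : q != 0 by apply: contraNneq p0; rewrite Epq => ->; rewrite mul0r.
have le_m0 : (m0 <= e.+1)%N.
  by rewrite -ltnS -(size_char_poly B) Epq size_mulXn // -addn1 leq_add2l size_poly_gt0.
have : coprimep q ('X ^+ e.+1).
  by rewrite coprimep_expr // -['X]subr0 -polyC0 coprimep_XsubC.
move/Bezout_eq1_coprimepP => [[r s] /= Ers].
(* Multiplying the Bezout relation by ['X^m0] and evaluating at [B] kills the term with the
   characteristic polynomial, so [B ^+ e.+1] is a multiple of its own square. *)
have EB : B ^+ e.+1 = B ^+ e.+1 * B ^+ e.+1 * horner_mx B s.
  have Em : B ^+ m0 = B ^+ e.+1 * B ^+ m0 * horner_mx B s.
    have Ep : 'X^m0 = r * char_poly B + 'X^(e.+1) * 'X^m0 * s.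
      rewrite Epq -[LHS]mul1r -Ers mulrDl mulrA; congr (_ + _).
      by rewrite mulrC [s * _]mulrC mulrA [_ * 'X^m0]mulrC.
    move/(congr1 (horner_mx B)): Ep.
    by rewrite rmorphD !rmorphM /= Cayley_Hamilton mulr0 add0r !rmorphXn /= horner_mx_X.
  have EN : B ^+ e.+1 = B ^+ (e.+1 - m0) * B ^+ m0 by rewrite -exprD subnK.
  have CN : B ^+ (e.+1 - m0) * B ^+ e.+1 = B ^+ e.+1 * B ^+ (e.+1 - m0).
    by rewrite -!exprD addnC.
  rewrite [LHS]EN.
  transitivity (B ^+ (e.+1 - m0) * (B ^+ e.+1 * B ^+ m0 * horner_mx B s)).
    by rewrite -Em.
  by rewrite !mulrA CN -(mulrA (B ^+ e.+1)) -EN.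
by rewrite EB mulmxA -[B ^+ _ * B ^+ _]/(B ^+ e.+1 *m B ^+ e.+1) mulmxA uB0 mul0mx.
Qed.

(** Only 0 in the row space of [C] is killed by [B], so the kernel vector [u] lies outside that
    space. *)
Lemma row_free_disjoint r e (C : 'M[k]_(r, e)) (u : 'rV[k]_e) (B : 'M[k]_e) :
  row_free (C *m B) -> u != 0 -> u *m B = 0 -> \rank (C + u)%MS = r.+1.
Proof.
move=> Cfree u0 uB0.
have Cr : \rank C = r.
  apply/eqP; rewrite eqn_leq rank_leq_row.
  by have := mxrankM_maxl C B; rewrite (eqP Cfree).
rewrite mxrank_disjoint_sum ?Cr ?rank_rV ?u0 ?addn1 //.
apply/eqP/rowV0P => x; rewrite sub_capmx => /andP[/submxP[y ->]].
move/submxP=> [z Ez]; have /eqP := congr1 (mulmx^~ B) Ez.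
by rewrite -mulmxA -mulmxA uB0 mulmx0 mulmx_free_eq0 // => /eqP ->; rewrite mul0mx.
Qed.

(** Every [B h] is nilpotent on the kernel of [C]. Treating the list one member at a time, replace
    [w] by the last nonzero vector among the [w *m B h ^+ j]; commutation keeps it in the kernel of
    [C] and of the matrices already treated. *)
Lemma common_kernel e (T : eqType) (s : seq T) (B : T -> 'M[k]_e.+1)
    (C : 'M[k]_e.+1) (N : nat) (u : 'rV[k]_e.+1) :
  (forall h h', GRing.comm (B h) (B h')) -> (forall h, GRing.comm (B h) C) ->
  (forall h (w : 'rV_e.+1), w *m C = 0 -> w *m B h ^+ N = 0) ->
  u != 0 -> u *m C = 0 ->
  exists w : 'rV_e.+1, [/\ w != 0, w *m C = 0 & {in s, forall h, w *m B h = 0}].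
Proof.
move=> BB BC nilB u0 uC; elim: s => [|h s [w [w0 wC ws]]]; first by exists u.
have exN : exists j, w *m B h ^+ j == 0 by exists N; rewrite nilB.
case: (ex_minnP exN) => -[|j]; first by rewrite expr0 mulmx1 (negPf w0).
move=> Ej minj; exists (w *m B h ^+ j); split.
- by apply/negP => /minj; rewrite ltnn.
- have BjC : B h ^+ j *m C = C *m B h ^+ j.
    exact/esym/(commrX j)/commr_sym/BC.
  by rewrite -mulmxA BjC mulmxA wC mul0mx.
- move=> h'; rewrite inE => /predU1P[->|h's].
    by rewrite -mulmxA -[B h ^+ j *m B h]/(B h ^+ j * B h) -exprSr; apply/eqP.
  have BjB : B h ^+ j *m B h' = B h' *m B h ^+ j.
    exact/esym/(commrX j)/BB.
  by rewrite -mulmxA BjB mulmxA ws ?mul0mx.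
Qed.

(* Maximise the rank of [B v ^+ e.+1]. If [B v] is not invertible, some
   [B (p h)] is not nilpotent on the kernel of that power; a point of the line
   through [v] and [p h] keeps the rank on the image of [B v ^+ e.+1] and gains
   one on the kernel. *)
Lemma generic_unitmx d e (B : 'rV[k]_d -> 'M[k]_e) (T : finType)
    (p : T -> 'rV[k]_d) :
  infinite_set [set: k] ->
  (forall i j, polyfun (fun v => B v i j)) ->
  (forall v w, B v *m B w = B w *m B v) ->
  (forall u : 'rV_e, (forall h, u *m B (p h) = 0) -> u = 0) ->
  exists v, B v \in unitmx.
Proof.
move=> kinf; case: e B => [|e] B pB BB kerB.
  by exists 0; rewrite unitmxE det_mx00 unitr1.
set N := e.+1.
have BN v w i j : GRing.comm (B v ^+ i) (B w ^+ j).
  by apply/commrX/commr_sym/commrX; apply: BB.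
pose P r := `[< exists v, \rank (B v ^+ N) = r >].
have exP : exists r, P r by exists (\rank (B 0 ^+ N)); apply/asboolP; exists 0.
have ubP r : P r -> (r <= N)%N by move=> /asboolP[v <-]; apply: rank_leq_row.
case: (ex_maxnP exP ubP) => r /asboolP[v Er] maxr.
have [ker0|kerN0] := eqVneq (kermx (B v ^+ N)) 0.
  exists v; rewrite -row_free_unit -kermx_eq0; apply/eqP/row_matrixP => i.
  rewrite row0; apply: (row_free_inj (A := B v ^+ N)).
    by rewrite -kermx_eq0 ker0.
  by rewrite mul0mx {1}/N exprS mulmxA -row_mul mulmx_ker row0 mul0mx.
have [u0 [u0N0 u0K]] : exists u : 'rV_N, u != 0 /\ u *m B v ^+ N = 0.
  have /rowV0Pn[u uker un0] := kerN0.
  by exists u; split=> //; apply/sub_kermxP.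
have [h [u uK uN0]] : exists h, exists2 u : 'rV_N,
    u *m B v ^+ N = 0 & u *m B (p h) ^+ N != 0.
  (* Otherwise every [B (p h)] is nilpotent on the kernel of [B v ^+ N], and [common_kernel] yields
     a nonzero vector that contradicts [kerB]. *)
  apply: contrapT => H.
  have nilB h (w : 'rV_N) : w *m B v ^+ N = 0 -> w *m B (p h) ^+ N = 0.
    by move=> wK; apply/eqP/negPn/negP => wn0; apply: H; exists h, w.
  have [||w [w0 _ wB]] := common_kernel (enum T) _ _ nilB u0N0 u0K.
  - by move=> h h'; apply: BB.
  - by move=> h; apply: (BN _ _ 1%N).
  by case/eqP: w0; apply: kerB => h; apply: wB; rewrite mem_enum.
have [j uj0] : exists j, (u *m B (p h) ^+ N) 0 j != 0.
  apply: contrapT => H; case/eqP: uN0; apply/rowP => j; rewrite !mxE.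
  by apply/eqP/negPn/negP => uj; apply: H; exists j; rewrite mxE.
set R := row_base (B v ^+ N).
(* [B v ^+ N] is injective on its own image by [kermx_exp_stable]. This is the case w = v of the
   freeness of [R *m B w ^+ N *m B v ^+ N], which [row_free_disjoint] will require. *)
have Rfree : row_free (R *m B v ^+ N *m B v ^+ N).
  apply: inj_row_free => x; rewrite 2!mulmxA => /kermx_exp_stable.
  have /submxP[Y EY] : (x *m R <= B v ^+ N)%MS.
    by rewrite (submx_trans (submxMl _ _)) ?eq_row_base.
  rewrite EY => /kermx_exp_stable; rewrite -EY => /eqP.
  by rewrite mulmx_free_eq0 ?row_base_free // => /eqP.
have [Z EZ] := row_freeP Rfree.
(* The first function is 1 at [v], and where it is nonzero the image part keeps rank [r]; the second
   is nonzero at [p h] and keeps [u *m B w ^+ N] nonzero. *)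
have [||| w [Fw Hw]] := @polyfun_common_nonzero _ _
    (fun w => \det (R *m B w ^+ N *m B v ^+ N *m Z))
    (fun w => (u *m B w ^+ N) 0 j) v (p h) kinf _ _ _ uj0.
- apply: polyfun_det => i1 i2; do !apply: polyfun_mulmx => *; try exact: polyfun_const.
  exact: polyfun_expmx.
- by apply: polyfun_mulmx => *; [exact: polyfun_const | exact: polyfun_expmx].
- by rewrite EZ det1 oner_neq0.
have wfree : row_free (R *m B w ^+ N *m B v ^+ N).
  apply: inj_row_free => x xR.
  apply: (row_free_inj (A := R *m B w ^+ N *m B v ^+ N *m Z)).
    by rewrite row_free_unit unitmxE unitfE.
  by rewrite mulmxA xR !mul0mx.
have uw0 : u *m B w ^+ N != 0.
  by apply: contraNneq Hw => ->; rewrite mxE.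
(* By commutation [u *m B w ^+ N] is killed by [B v ^+ N], so [B w ^+ N] has rank at least [r.+1],
   against the choice of [r]. *)
have := row_free_disjoint wfree uw0.
rewrite -mulmxA [_ *m B v ^+ N]BN mulmxA uK mul0mx => /(_ erefl) rk.
have : (\rank (B w ^+ N) <= r)%N by apply: maxr; apply/asboolP; exists w.
rewrite -Er leqNgt -rk; case/negP; apply: mxrankS.
by rewrite addsmx_sub !submxMl.
Qed.

End CommutingMatrices.

(** * Adding one member to a finite family *)

Lemma sum_option (V : nmodType) (T : finType) (F : option T -> V) :
  \sum_o F o = \sum_t F (Some t) + F None.
Proof.
rewrite (bigD1 None) //= addrC; congr (_ + _).
rewrite (reindex_omap Some id) //=; last by case.
by apply: eq_bigl => t; rewrite eqxx.
Qed.

Lemma sum_enum_val (V : nmodType) (I : finType) (F : I -> V) :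
  \sum_(i < #|{: I}|) F (enum_val i) = \sum_i F i.
Proof. by rewrite [RHS](reindex _ (onW_bij _ (@enum_val_bij I))). Qed.

Definition extend (T U : Type) (z : T -> U) (t : U) (o : option T) : U :=
  if o is Some j then z j else t.

(** * Graded subalgebras and their ideals *)

Section GradedSubalgebra.
Variables (k : fieldType) (S : comAlgType k).

(* A polynomial records the homogeneous components of an element; the element
   itself is the value at 1. *)
Record graded_subalgebra (A : nat -> set S) : Prop := GradedSubalgebra {
  gsub0 : forall m, A m 0;
  gsubP : forall m c y z, A m y -> A m z -> A m (c *: y + z);
  gsub1 : A 0 1;
  gsub_degree0 : forall y, A 0 y -> exists c, y = c%:A;
  gsubM : forall i j y z, A i y -> A j z -> A (i + j)%N (y * z);
  gsub_direct : forall p : {poly S}, (forall i, A i p`_i) -> p.[1] = 0 -> p = 0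
}.

Variable A : nat -> set S.
Hypothesis gA : graded_subalgebra A.

Definition dsum : set S := [set y | exists p : {poly S},
  (forall i, A i p`_i) /\ y = p.[1]].

Lemma gsubD m y z : A m y -> A m z -> A m (y + z).
Proof. by move=> Ay Az; rewrite -[y]scale1r; apply: gsubP. Qed.

Lemma gsubZ m c y : A m y -> A m (c *: y).
Proof. by move=> Ay; rewrite -[_ *: _]addr0; apply: gsubP => //; apply: gsub0. Qed.

Lemma gsub_sum m (I : Type) (r : seq I) (F : I -> S) :
  (forall i, A m (F i)) -> A m (\sum_(i <- r) F i).
Proof.
by move=> AF; elim/big_ind: _ => //; [apply: gsub0 | move=> *; apply: gsubD].
Qed.

Lemma gsubX m y i : A m y -> A (m * i)%N (y ^+ i).
Proof.
move=> Ay; elim: i => [|i IHi]; first by rewrite muln0; apply: gsub1.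
by rewrite mulnS exprS; apply: gsubM.
Qed.

Lemma dsumP c y z : dsum y -> dsum z -> dsum (c *: y + z).
Proof.
move=> [p [Ap ->]] [q [Aq ->]]; exists (c%:A *: p + q); split=> [i|].
  by rewrite coefD coefZ mulr_algl; apply: gsubP.
by rewrite hornerD hornerZ mulr_algl.
Qed.

Lemma dsum_gsub m y : A m y -> dsum y.
Proof.
move=> Ay; exists (y *: 'X^m); split=> [i|].
  rewrite coefZ coefXn; case: eqP => [->|_]; rewrite ?mulr1 ?mulr0 //.
  exact: gsub0.
by rewrite hornerZ hornerXn expr1n mulr1.
Qed.

Lemma dsum0 : dsum 0.
Proof. exact: dsum_gsub (gsub0 gA 0). Qed.

Lemma dsum1 : dsum 1.
Proof. exact: dsum_gsub (gsub1 gA). Qed.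

Lemma dsumD y z : dsum y -> dsum z -> dsum (y + z).
Proof. by move=> Ty Tz; rewrite -[y]scale1r; apply: dsumP. Qed.

Lemma dsumZ c y : dsum y -> dsum (c *: y).
Proof. by move=> Ty; rewrite -[_ *: _]addr0; apply: dsumP => //; apply: dsum0. Qed.

Lemma dsumM y z : dsum y -> dsum z -> dsum (y * z).
Proof.
move=> [p [Ap ->]] [q [Aq ->]]; exists (p * q); split=> [i|]; last by rewrite hornerM.
rewrite coefM; apply: gsub_sum => j.
by have := gsubM gA (Ap j) (Aq (i - j)%N); rewrite subnKC // -ltnS.
Qed.

Lemma dsum_subalg : GRing.subalg_closed (mem dsum).
Proof.
split; first exact/mem_set/dsum1.
- by move=> c y z /set_mem Ty /set_mem Tz; apply/mem_set/dsumP.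
- by move=> y z /set_mem Ty /set_mem Tz; apply/mem_set/dsumM.
Qed.

(** Lift the identity to polynomials, with ['X] times a lift of [f t] for the coefficient of [z t],
    since [z t] has degree 1. By directness, equality at 1 is equality of polynomials; compare the
    coefficients of degree [m.+1]. *)
Lemma homogeneous_part (T L : finType) (z : T -> S) (P : L -> {poly S})
    (c : L -> k) (f : T -> S) m y :
  (forall l i, A i (P l)`_i) -> (forall t, A 1 (z t)) -> (forall t, dsum (f t)) ->
  A m.+1 y -> y = \sum_l c l *: (P l).[1] + \sum_t f t * z t ->
  exists g, (forall t, A m (g t)) /\
    y = \sum_l c l *: (P l)`_m.+1 + \sum_t g t * z t.
Proof.
move=> AP Az Tf Ay Ey.
have [Q HQ] := choice Tf.
have : \sum_l (c l)%:A *: P l + \sum_t z t *: ('X * Q t) - y *: 'X^(m.+1) = 0.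
  apply: (gsub_direct gA) => [i|].
    rewrite coefB coefD !coef_sum -scaleN1r addrC; apply: gsubP => //.
      rewrite coefZ coefXn; case: eqP => [->|_]; rewrite ?mulr1 ?mulr0 //.
      exact: gsub0.
    apply: gsubD; [apply: gsub_sum => l | apply: gsub_sum => t].
      by rewrite coefZ mulr_algl; apply: gsubZ.
    rewrite coefZ coefXM; case: i => [|i]; first by rewrite mulr0; apply: gsub0.
    by rewrite -add1n; apply: (gsubM gA) => //; have [AQ _] := HQ t; apply: AQ.
  rewrite hornerD hornerN hornerD !horner_sum hornerZ hornerXn expr1n mulr1.
  apply/eqP; rewrite subr_eq0 Ey; apply/eqP.
  congr (_ + _); apply: eq_bigr => i _; first by rewrite hornerZ mulr_algl.
  by rewrite hornerZ hornerM hornerX mul1r mulrC; have [_ ->] := HQ i.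
move=> /(congr1 (fun p : {poly S} => p`_m.+1)); rewrite coefB coef0 => /eqP.
rewrite subr_eq0 coefZ coefXn eqxx mulr1 => /eqP <-.
exists (fun t => (Q t)`_m); split=> [t|]; first by have [AQ _] := HQ t; apply: AQ.
rewrite coefD !coef_sum; congr (_ + _); apply: eq_bigr => i _.
  by rewrite coefZ mulr_algl.
by rewrite coefZ coefXM mulrC.
Qed.

(** Coefficients lie in [dsum], so this is an ideal of the graded subalgebra rather than of [S]. *)
Definition idl (T : finType) (z : T -> S) : set S :=
  [set y | exists f, (forall t, dsum (f t)) /\ y = \sum_t f t * z t].

Section Ideal.
Variables (T : finType) (z : T -> S).

Lemma idl0 : idl z 0.
Proof.
exists (fun=> 0); split=> [t|]; first exact: dsum0.
by rewrite big1 // => t _; rewrite mul0r.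
Qed.

Lemma idlP c x y : dsum c -> idl z x -> idl z y -> idl z (c * x + y).
Proof.
move=> Tc [f [Tf ->]] [g [Tg ->]]; exists (fun t => c * f t + g t); split=> [t|].
  by apply: dsumD => //; apply: dsumM.
rewrite mulr_sumr -big_split; apply: eq_bigr => t _ /=.
by rewrite mulrDl mulrA.
Qed.

Lemma idlM c x : dsum c -> idl z x -> idl z (c * x).
Proof. by move=> Tc Ix; rewrite -[_ * _]addr0; apply: idlP => //; apply: idl0. Qed.

Lemma idlZ c x : idl z x -> idl z (c *: x).
Proof. by rewrite -mulr_algl; apply: idlM; apply: dsumZ; apply: dsum1. Qed.

Lemma idlD x y : idl z x -> idl z y -> idl z (x + y).
Proof. by move=> Ix Iy; rewrite -[x]mul1r; apply: idlP => //; apply: dsum1. Qed.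

Lemma idlB x y : idl z x -> idl z y -> idl z (x - y).
Proof. by move=> Ix Iy; rewrite -[- y]scaleN1r; apply: idlD => //; apply: idlZ. Qed.

Lemma idl_sum (I : Type) (r : seq I) (F : I -> S) :
  (forall i, idl z (F i)) -> idl z (\sum_(i <- r) F i).
Proof.
by move=> AF; elim/big_ind: _ => //; [apply: idl0 | move=> *; apply: idlD].
Qed.

Lemma idl_homogeneous m y : (forall t, A 1 (z t)) -> A m.+1 y -> idl z y ->
  exists g, (forall t, A m (g t)) /\ y = \sum_t g t * z t.
Proof.
move=> Az Ay [f [Tf Ey]].
(* The constants are indexed by the empty type, which leaves only the sum over [T]. *)
have [||g [Ag Eg]] := @homogeneous_part T void z (fun=> 0) (fun=> 0) f m y _ Az Tf Ay.
- by case.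
- by rewrite [X in X + _]big1 ?add0r //; case.
by exists g; split=> //; rewrite {1}Eg [X in X + _]big1 ?add0r //; case.
Qed.

Lemma idl_extendP t y :
  idl (extend z t) y <-> exists2 g, dsum g & idl z (y - g * t).
Proof.
split=> [[f [Tf ->]]|[g Tg [f [Tf Ey]]]].
  exists (f None) => //; exists (fun j => f (Some j)); split=> //.
  by rewrite sum_option /= addrK.
exists (extend f g); split; first by case=> [j|] /=.
by rewrite sum_option /= -Ey subrK.
Qed.

End Ideal.

Definition contains_high_degrees (T : finType) (z : T -> S) : Prop :=
  exists D, forall m y, (D <= m)%N -> A m y -> idl z y.

Definition finite_span (V : set S) : Prop := exists q (a : 'I_q -> S),
  (forall l, V (a l)) /\ forall y, V y -> exists c : 'I_q -> k, y = \sum_l c l *: a l.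

(** The elements congruent to a constant modulo the ideal form a subalgebra containing every
    [z t]. *)
Lemma gen_subalg_const_idl (T : finType) (z : T -> S) y :
  (forall t, A 1 (z t)) -> gen_subalg [set z t | t in [set: T]] y ->
  exists c, idl z (y - c%:A).
Proof.
move=> Az gy.
(* Membership in [dsum] is carried along because closure under products multiplies a member of the
   ideal by the factor [v]. *)
suff [] : (dsum `&` [set y | exists c, idl z (y - c%:A)]) y by [].
move: y gy; apply: smallest_sub.
  split; first apply/mem_set; first split; first exact: dsum1.
  - by exists 1; rewrite scale1r subrr; apply: idl0.
  - move=> c u v /set_mem[Tu [a Ia]] /set_mem[Tv [b Ib]]; apply/mem_set.
    split; first exact: dsumP.
    exists (c * a + b).
    have -> : c *: u + v - (c * a + b)%:A = c *: (u - a%:A) + (v - b%:A).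
      by rewrite scalerBr scalerDl opprD addrACA scalerA.
    by apply: idlD => //; apply: idlZ.
  - move=> u v /set_mem[Tu [a Ia]] /set_mem[Tv [b Ib]]; apply/mem_set.
    split; first exact: dsumM.
    exists (a * b).
    have -> : u * v - (a * b)%:A = v * (u - a%:A) + a%:A * (v - b%:A).
      by rewrite !mulrBr [v * u]mulrC [v * _]mulrC addrA subrK mulr_algl scalerA.
    apply: idlP => //; apply: idlM => //; apply: dsumZ; apply: dsum1.
move=> _ [t _ <-]; split; first exact: dsum_gsub (Az t).
exists 0; rewrite scale0r subr0; exists (fun s => (s == t)%:R); split=> [s|].
  by case: eqP => _; [apply: dsum1 | apply: dsum0].
rewrite (bigD1 t) //= eqxx mul1r big1 ?addr0 // => s /negPf ->.
by rewrite mul0r.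
Qed.

(** * Module finiteness and graded Nakayama *)

Section ModuleFinite.
Variables (T : finType) (z : T -> S).
Hypothesis Az : forall t, A 1 (z t).
Let Z := [set z t | t in [set: T]].

(** Modulo the ideal, the coefficients from [gen_subalg Z] become constants; it remains to take the
    component of degree [m.+1]. The [P l] collect the components of the module generators. *)
Lemma module_finite_components : module_finite (gen_subalg Z) dsum ->
  exists q (P : 'I_q -> {poly S}), (forall l i, A i (P l)`_i) /\
    forall m y, A m.+1 y -> exists c g, (forall t, A m (g t)) /\
      y = \sum_l c l *: (P l)`_m.+1 + \sum_t g t * z t.
Proof.
move=> [_ [q [a [Ta Ha]]]]; have [P HP] := choice Ta.
exists q, P; split=> [l|m y Ay]; first by have [] := HP l.
have [b [gb Ey]] := Ha y (dsum_gsub Ay).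
have [c Hc] := choice (fun l => gen_subalg_const_idl Az (gb l)).
have [f [Tf Ef]] : idl z (\sum_l (b l - (c l)%:A) * a l).
  by apply: idl_sum => l; rewrite mulrC; apply: idlM.
have AP l i : A i (P l)`_i by have [] := HP l.
have [|g [Ag Eg]] := homogeneous_part AP Az Tf Ay (c := c).
  rewrite -Ef -big_split Ey; apply: eq_bigr => l _ /=.
  by have [_ <-] := HP l; rewrite mulrBl mulr_algl addrCA subrr addr0.
by exists c, g.
Qed.

Lemma contains_high_degrees_of_module_finite :
  module_finite (gen_subalg Z) dsum -> contains_high_degrees z.
Proof.
move=> /module_finite_components[q [P [AP HP]]].
(* Above all degrees occurring in the module generators the constant combination vanishes. *)
exists (\max_l size (P l)).+1 => -[//|m] y ltm Ay.
have [c [g [Ag Ey]]] := HP m y Ay.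
exists g; split=> [t|]; first exact: dsum_gsub (Ag t).
rewrite {1}Ey big1 ?add0r // => l _; rewrite nth_default ?scaler0 //.
exact: leq_trans (leq_bigmax (F := fun l => size (P l)) l) (ltnW ltm).
Qed.

(** Induction on the degree: components of the module generators, together with products of the
    [z t] with a spanning family one degree lower, span the next degree. *)
Lemma finite_span_of_module_finite m :
  module_finite (gen_subalg Z) dsum -> finite_span (A m).
Proof.
move=> /module_finite_components[q [P [AP HP]]].
elim: m => [|m [r [a [Aa Ha]]]].
  exists 1%N, (fun=> 1); split=> [_|y /(gsub_degree0 gA)[c ->]]; first exact: gsub1.
  by exists (fun=> c); rewrite big_ord1.
pose I := ('I_q + T * 'I_r)%type.
pose B (i : I) := match i with inl l => (P l)`_m.+1 | inr (t, l) => a l * z t end.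
exists #|{: I}|, (fun i => B (enum_val i)); split=> [i|y Ay].
  case: (enum_val i) => [l|[t l]] /=; first exact: AP.
  by rewrite -addn1; apply: gsubM.
have [c [g [Ag Ey]]] := HP m y Ay.
have [e He] := choice (fun t => Ha _ (Ag t)).
exists (fun i => match enum_val i with inl l => c l | inr (t, l) => e t l end).
pose F (i : I) := match i with inl l => c l | inr (t, l) => e t l end *: B i.
rewrite (sum_enum_val F) big_sumType /= {1}Ey; congr (_ + _).
transitivity (\sum_t \sum_l F (inr (t, l))).
  apply: eq_bigr => t _; rewrite {1}(He t) mulr_suml.
  by apply: eq_bigr => l _; rewrite -scalerAl.
by rewrite pair_bigA; apply: eq_bigr => -[].
Qed.

Lemma finite_span_low_degrees D : (forall m, finite_span (A m)) ->
  exists q (a : 'I_q -> S), (forall l, dsum (a l)) /\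
    forall m y, (m < D)%N -> A m y -> exists c : 'I_q -> k, y = \sum_l c l *: a l.
Proof.
move=> fA; elim: D => [|D [q [a [Ta Ha]]]].
  by exists 0%N, (fun=> 0); split=> // l; apply: dsum0.
have [r [b [Ab Hb]]] := fA D.
exists (q + r)%N, (fun i => match split i with inl l => a l | inr l => b l end).
split=> [i|m y]; first by case: (split i) => l //; apply: dsum_gsub (Ab l).
rewrite ltnS leq_eqVlt => /orP[/eqP -> /Hb[c ->]|ltm Ay].
  exists (fun i => match split i with inl l => 0 | inr l => c l end).
  rewrite big_split_ord /= [X in _ = X + _]big1 ?add0r.
    by apply: eq_bigr => l _; rewrite (unsplitK (inr l)).
  by move=> l _; rewrite (unsplitK (inl l)) scale0r.
have [c ->] := Ha m y ltm Ay.
exists (fun i => match split i with inl l => c l | inr l => 0 end).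
rewrite big_split_ord /= [X in _ = _ + X]big1 ?addr0.
  by apply: eq_bigr => l _; rewrite (unsplitK (inl l)).
by move=> l _; rewrite (unsplitK (inr l)) scale0r.
Qed.

(** Spanning elements of degree at most [D] generate the module: an element of larger degree is a
    combination of the [z t] with coefficients one degree lower, to which induction applies. *)
Lemma module_finite_of_contains_high_degrees :
  (forall m, finite_span (A m)) -> contains_high_degrees z ->
  module_finite (gen_subalg Z) dsum.
Proof.
move=> fA [D HD]; split.
  apply: smallest_sub; first exact: dsum_subalg.
  by move=> _ [t _ <-]; apply: dsum_gsub (Az t).
have gZ t : gen_subalg Z (z t) by apply: sub_gen_smallest; exists t.
have [gen1 genP genM] := gen_subalg_closed Z.
have [q [a [Ta Ha]]] := finite_span_low_degrees D.+1 fA.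
pose M y := exists b : 'I_q -> S,
  (forall i, gen_subalg Z (b i)) /\ y = \sum_i b i * a i.
have gen0 : gen_subalg Z 0.
  have := genP (-1) 1 1 gen1 gen1; rewrite scaleN1r addNr => /set_mem //.
have genD u v : gen_subalg Z u -> gen_subalg Z v -> gen_subalg Z (u + v).
  by move=> gu gv; rewrite -[u]scale1r; apply/set_mem/genP; apply/mem_set.
have genM' u v : gen_subalg Z u -> gen_subalg Z v -> gen_subalg Z (u * v).
  by move=> gu gv; apply/set_mem/genM; apply/mem_set.
have gen_const c : gen_subalg Z c%:A.
  by rewrite -[_ *: _]addr0; apply/set_mem/genP => //; apply/mem_set.
have M0 : M 0.
  by exists (fun=> 0); split=> //; rewrite big1 // => i _; rewrite mul0r.
have MP u x y : gen_subalg Z u -> M x -> M y -> M (x * u + y).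
  move=> gu [b [gb ->]] [b' [gb' ->]]; exists (fun i => u * b i + b' i).
  split=> [i|]; first by apply: genD => //; apply: genM'.
  rewrite mulr_suml -big_split; apply: eq_bigr => i _ /=.
  by rewrite mulrDl mulrAC [u * _]mulrC.
have MA m y : A m y -> M y.
  elim/ltn_ind: m y => m IHm y Ay; have [ltD|leD] := ltnP m D.+1.
    have [c ->] := Ha m y ltD Ay; exists (fun i => (c i)%:A); split=> //.
    by apply: eq_bigr => i _; rewrite mulr_algl.
  case: m IHm Ay leD => // m IHm Ay leD.
  have [g [Ag ->]] := idl_homogeneous Az Ay (HD _ _ (ltnW leD) Ay).
  elim/big_ind: _ => // [u v Mu Mv|t _].
    by rewrite -[u]mulr1; apply: MP => //; apply/set_mem.
  by rewrite -[_ * _]addr0; apply: MP => //; apply: IHm (Ag t).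
exists q, a; split=> // _ [p [Ap ->]].
suff : M p.[1] by [].
rewrite horner_coef; elim/big_ind: _ => // [u v Mu Mv|i _].
  by rewrite -[u]mulr1; apply: MP => //; apply/set_mem.
by rewrite expr1n mulr1; apply: MA (Ap i).
Qed.

End ModuleFinite.
End GradedSubalgebra.

(** * Generators depending polynomially on a parameter, and openness *)

Section PolynomialFamily.
Variables (k : fieldType) (S : comAlgType k) (A : nat -> set S).
Hypothesis gA : graded_subalgebra A.
Hypothesis fA : forall m, finite_span (A m).
Variables (T : finType) (z : T -> S) (Az : forall t, A 1 (z t)).
Variables (d : nat) (I : finType) (mu : I -> 'rV[k]_d -> k) (omega : I -> S).
Hypotheses (mu_poly : forall i, polyfun (mu i)) (Aomega : forall i, A 1 (omega i)).

Let a v := \sum_i mu i v *: omega i.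

Lemma polynomial_family_homogeneous v : A 1 (a v).
Proof. by apply: gsub_sum => // i; apply: gsubZ. Qed.

Lemma extend_homogeneous t : A 1 t -> forall o, A 1 (extend z t o).
Proof. by move=> At [j|] /=. Qed.

(** The family [x] reduces the question to the single degree [m.+1]: beyond it, elements are
    combinations of the [x u] with coefficients one degree lower. *)
Lemma contains_high_degrees_open (U : finType) (x : U -> S) v0 :
  (forall u, A 1 (x u)) -> contains_high_degrees A x ->
  contains_high_degrees A (extend z (a v0)) ->
  exists F, [/\ polyfun F, F v0 != 0 &
    forall v, F v != 0 -> contains_high_degrees A (extend z (a v))].
Proof.
move=> Ax [D0 HD0] [D1 HD1]; pose m := maxn D0 D1.
have [q [b [Ab Hb]]] := fA m.+1.
have Aav0 := extend_homogeneous (polynomial_family_homogeneous v0).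
have Hf s : exists g : option T -> S, (forall o, A m (g o)) /\
    b s = \sum_o g o * extend z (a v0) o.
  apply: (idl_homogeneous gA Aav0 (Ab s)); apply: HD1 (Ab s).
  by rewrite (leq_trans (leq_maxr D0 _)).
have [f {}Hf] := choice Hf.
have Hg (p : I * 'I_q) : exists c : 'I_q -> k,
    omega p.1 * f p.2 None = \sum_l c l *: b l.
  by apply/Hb/(gsubM gA (Aomega _)); have [Af _] := Hf p.2.
have [c Hc] := choice Hg.
(* Row [s] of [N v] expresses in the [b l] what the combination for [b s] becomes when [a v0] is
   replaced by [a v], namely [b s + (a v - a v0) * f s None]. *)
pose N v : 'M_q := \matrix_(s, l)
  ((s == l)%:R + \sum_i (mu i v - mu i v0) * c (i, s) l).
have N1 : N v0 = 1%:M.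
  apply/matrixP => s l; rewrite !mxE big1 ?addr0 // => i _.
  by rewrite subrr mul0r.
have Nb v s : idl A (extend z (a v)) (\sum_l N v s l *: b l).
  exists (f s); split=> [o|]; first by have [Af _] := Hf s; apply: dsum_gsub (Af o).
  have -> : \sum_l N v s l *: b l = b s + (a v - a v0) * f s None.
    under eq_bigr do rewrite mxE scalerDl.
    rewrite big_split /= (bigD1 s) //= eqxx scale1r big1 ?addr0; last first.
      by move=> l; rewrite eq_sym => /negPf ->; rewrite scale0r.
    congr (_ + _); rewrite -sumrB mulr_suml.
    under eq_bigr do rewrite scaler_suml.
    rewrite exchange_big; apply: eq_bigr => i _ /=.
    rewrite -scalerBl -scalerAl (Hc (i, s)) scaler_sumr.
    by apply: eq_bigr => l _; rewrite scalerA.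
  rewrite (Hf s).2 !sum_option /= -addrA; congr (_ + _).
  by rewrite mulrBl [f s None * _]mulrC addrC subrK mulrC.
exists (fun v => \det (N v)); split.
- apply: polyfun_det => s l; apply: polyfun_ext; first by move=> v; rewrite mxE.
  apply: polyfunD (polyfun_const _ _) _; apply: polyfun_sum => i.
  apply: polyfunM (polyfun_const _ _); apply: polyfunD => //.
  exact: polyfun_const.
- by rewrite N1 det1 oner_neq0.
move=> v detN; have Nu : N v \in unitmx by rewrite unitmxE unitfE.
have Iall y : A m.+1 y -> idl A (extend z (a v)) y.
  move=> /Hb[e ->].
  have -> : \sum_l e l *: b l =
     \sum_s (\row_l e l *m invmx (N v)) 0 s *: (\sum_l N v s l *: b l).
    transitivity (\sum_l (\row_l e l *m invmx (N v) *m N v) 0 l *: b l).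
      by rewrite mulmxKV //; apply: eq_bigr => l _; rewrite mxE.
    under [RHS]eq_bigr do rewrite scaler_sumr.
    rewrite exchange_big; apply: eq_bigr => l _ /=.
    by rewrite mxE scaler_suml; apply: eq_bigr => s _; rewrite scalerA.
  by apply: idl_sum => // s; apply: idlZ.
exists m.+1; elim=> // n IHn y; rewrite leq_eqVlt => /predU1P[<-|]; first exact: Iall.
rewrite ltnS => ltn Ay.
have /(idl_homogeneous gA Ax Ay)[g [Ag ->]] : idl A x y.
  apply: HD0 Ay; rewrite (leq_trans (leq_maxl _ D1)) //.
  by rewrite (leq_trans (ltnW ltn)).
apply: idl_sum => // u; rewrite mulrC; apply: idlM => //; last exact: IHn.
exact: dsum_gsub (Ax u).
Qed.


(** * Multiplication operators on the degree-0 part of a localization *)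

Section Dehomogenization.
Variables (t : S) (At : A 1 t) (m e : nat) (b : 'I_e -> S).
Hypothesis Ab : forall l, A m (b l).

(** Under [b_span] and [b_free], the fractions [b l / t ^+ m] form a basis of the degree-0 part of
    the localization at [t] of [dsum A] modulo the ideal of [z]; [comb j u] is the numerator, over
    [t ^+ (m + j)], of the element with coordinates [u]. *)
Let comb j (u : 'rV[k]_e) := \sum_l u 0 l *: (t ^+ j * b l).

Hypothesis b_span : forall j y, A (m + j)%N y -> exists u, idl A z (y - comb j u).
Hypothesis b_free : forall j u, idl A z (comb j u) -> u = 0.

Let dsum_power j : dsum A (t ^+ j).
Proof. exact: (dsum_gsub gA (gsubX gA j At)). Qed.

Let combP j c u v : comb j (c *: u + v) = c *: comb j u + comb j v.
Proof.
rewrite /comb scaler_sumr -big_split; apply: eq_bigr => l _ /=.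
by rewrite !mxE scalerDl scalerA.
Qed.

Let comb_sum j (J : finType) (c : J -> k) (u : J -> 'rV_e) :
  comb j (\sum_i c i *: u i) = \sum_i c i *: comb j (u i).
Proof.
have comb0 : comb j 0 = 0 by rewrite /comb big1 // => l _; rewrite mxE scale0r.
have combD x y : comb j (x + y) = comb j x + comb j y.
  by rewrite -[x]scale1r combP !scale1r.
rewrite (big_morph (comb j) combD comb0); apply: eq_bigr => i _.
by rewrite -[_ *: u i]addr0 combP comb0 addr0.
Qed.

Let combX i j u : comb (i + j) u = t ^+ i * comb j u.
Proof.
rewrite /comb mulr_sumr; apply: eq_bigr => l _.
by rewrite exprD -mulrA scalerAr.
Qed.

(* [Y] is the matrix of [y / t ^+ j] acting on the degree-0 part of the
   localization at [t] of the quotient by the ideal of [z]. *)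
Definition acts_as j y (Y : 'M[k]_e) : Prop :=
  forall l, idl A z (y * b l - comb j (row l Y)).

Lemma acts_as_ex j y : A j y -> exists Y, acts_as j y Y.
Proof.
move=> Ay.
have Hl l : exists u, idl A z (y * b l - comb j u).
  by apply: b_span; rewrite addnC; apply: gsubM.
have [u Hu] := choice Hl.
exists (\matrix_(l, i) u l 0 i) => l.
have -> : row l (\matrix_(l, i) u l 0 i) = u l by apply/rowP => i; rewrite !mxE.
exact: Hu.
Qed.

Lemma acts_as_uniq j y Y Y' : acts_as j y Y -> acts_as j y Y' -> Y = Y'.
Proof.
move=> HY HY'; apply/row_matrixP => l; apply/eqP; rewrite -subr_eq0.
apply/eqP/(@b_free j); rewrite addrC -scaleN1r combP scaleN1r addrC.
have -> : comb j (row l Y) - comb j (row l Y') =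
    y * b l - comb j (row l Y') - (y * b l - comb j (row l Y)).
  by rewrite opprB [RHS]addrC addrA subrK.
exact: idlB.
Qed.

Lemma acts_as_sum j (J : finType) (c : J -> k) y (Y : J -> 'M_e) :
  (forall i, acts_as j (y i) (Y i)) ->
  acts_as j (\sum_i c i *: y i) (\sum_i c i *: Y i).
Proof.
move=> HY l; have -> : row l (\sum_i c i *: Y i) = \sum_i c i *: row l (Y i).
  by apply/rowP => h; rewrite !mxE !summxE; apply: eq_bigr => i _; rewrite !mxE.
rewrite comb_sum mulr_suml -sumrB; apply: idl_sum => // i.
by rewrite -scalerAl -scalerBr; apply: idlZ => //; apply: HY.
Qed.

(** Row [l] of a matrix holds the image of [b l], so composing operators multiplies the matrices in
    reverse order. *)
Lemma acts_asM i j y y' Y Y' : dsum A y ->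
  acts_as i y Y -> acts_as j y' Y' -> acts_as (i + j) (y * y') (Y' *m Y).
Proof.
move=> Ty HY HY' l.
have -> : row l (Y' *m Y) = \sum_h Y' l h *: row h Y.
  by rewrite row_mul mulmx_sum_row; apply: eq_bigr => h _; rewrite mxE.
rewrite comb_sum -(subrK (y * comb j (row l Y')) (_ * b l)) -mulrA -mulrBr -addrA.
apply: idlP => //.
rewrite {1}/comb mulr_sumr -sumrB; apply: idl_sum => // h.
rewrite mxE -scalerAr -scalerBr; apply: idlZ => //.
by rewrite addnC combX mulrCA -mulrBr; apply: idlM => //; apply: HY.
Qed.

Lemma acts_as_power j : acts_as j (t ^+ j) 1%:M.
Proof.
move=> l; rewrite row1 /comb (bigD1 l) //= mxE !eqxx scale1r big1 ?addr0.
  by rewrite subrr; apply: idl0.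
by move=> i /negPf il; rewrite mxE eqxx il scale0r.
Qed.

(** Both products represent [y * y'], whose matrix is unique. *)
Lemma acts_as_comm y y' Y Y' : A 1 y -> A 1 y' ->
  acts_as 1 y Y -> acts_as 1 y' Y' -> Y *m Y' = Y' *m Y.
Proof.
move=> Ay Ay' HY HY'; apply: (@acts_as_uniq (1 + 1) (y * y')).
  by rewrite mulrC; apply: acts_asM => //; apply: dsum_gsub Ay'.
by apply: acts_asM => //; apply: dsum_gsub Ay.
Qed.

(** Inverting [Y] writes each [t * b l], modulo the ideal of [z], as a combination of the [y * b h],
    which lie in the larger ideal. *)
Lemma contains_high_degrees_of_unitmx y Y : acts_as 1 y Y -> Y \in unitmx ->
  contains_high_degrees A (extend z y).
Proof.
move=> HY Yu.
have Iz x : idl A z x -> idl A (extend z y) x.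
  by move=> Ix; apply/idl_extendP => //; exists 0; [apply: dsum0 | rewrite mul0r subr0].
have comb1 u : idl A (extend z y) (comb 1 u).
  have -> : u = \sum_l (u *m invmx Y) 0 l *: row l Y.
    by rewrite -mulmx_sum_row mulmxKV.
  rewrite comb_sum; apply: idl_sum => // l; apply: idlZ => //.
  apply/idl_extendP => //; exists (b l); first exact: dsum_gsub (Ab l).
  rewrite -[_ - _]opprK opprB mulrC -scaleN1r; apply: idlZ => //; exact: HY.
(* The bound is [m.+1] rather than [m]: one factor [t] must be available for [comb1]. *)
exists m.+1 => n x ltmn Ax.
have [|u Hu] := @b_span (n - m) x; first by rewrite subnKC // ltnW.
rewrite -(subrK (comb (n - m) u) x); apply: idlD => //; first exact: Iz.
by rewrite -(subnK (n := n - m) (m := 1)) ?subn_gt0 // combX; apply: idlM.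
Qed.

Lemma exists_contains_high_degrees (H : finType) (p : H -> 'rV[k]_d) :
  infinite_set [set: k] -> contains_high_degrees A (fun h => a (p h)) ->
  exists v, contains_high_degrees A (extend z (a v)).
Proof.
move=> kinf [D HD].
have [Phi HPhi] := choice (fun i => acts_as_ex (Aomega i)).
pose B v := \sum_i mu i v *: Phi i.
have HB v : acts_as 1 (a v) (B v) by apply: acts_as_sum.
have Aa := polynomial_family_homogeneous.
have [|||v Bu] := @generic_unitmx _ _ _ B H p kinf.
- move=> l h; apply: polyfun_ext; first by move=> v; rewrite summxE.
  apply: polyfun_sum => i; apply: polyfun_ext; first by move=> v; rewrite mxE.
  exact: polyfunM (mu_poly i) (polyfun_const _ _).
- by move=> v w; apply: acts_as_comm (HB v) (HB w).
- move=> u uB.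
  have AtD : A D.+1 (t ^+ D.+1) by have := gsubX gA D.+1 At; rewrite mul1n.
  have [|g [Ag Eg]] := idl_homogeneous gA (fun h => Aa (p h)) AtD.
    exact: HD AtD.
  have [F HF] := choice (fun h => acts_as_ex (Ag h)).
  (* [t ^+ D.+1] acts as the identity and equals [\sum_h g h * a (p h)]; hence a vector killed by
     all [B (p h)] is zero. *)
  have E1 : 1%:M = \sum_h B (p h) *m F h.
    apply: (acts_as_uniq (acts_as_power D.+1)); rewrite Eg -addn1.
    rewrite [X in acts_as _ X](_ : _ = \sum_h 1 *: (g h * a (p h))); last first.
      by apply: eq_bigr => h _; rewrite scale1r.
    rewrite [X in acts_as _ _ X](_ : _ = \sum_h 1 *: (B (p h) *m F h)); last first.
      by apply: eq_bigr => h _; rewrite scale1r.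
    apply: acts_as_sum => h; apply: acts_asM => //; exact: dsum_gsub (Ag h).
  rewrite -[u]mulmx1 E1 mulmx_sumr big1 // => h _.
  by rewrite mulmxA uB mul0mx.
by exists v; apply: contains_high_degrees_of_unitmx (HB v) Bu.
Qed.

End Dehomogenization.

(** A spanning family of least size, where [m] may vary, is independent: a relation would allow one
    member to be dropped at the cost of raising [m]. *)
Lemma exists_dehomogenization (t : S) : A 1 t ->
  contains_high_degrees A (extend z t) ->
  exists m e (b : 'I_e -> S), [/\ forall l, A m (b l),
    forall j y, A (m + j)%N y ->
      exists u : 'rV_e, idl A z (y - \sum_l u 0 l *: (t ^+ j * b l)) &
    forall j (u : 'rV_e), idl A z (\sum_l u 0 l *: (t ^+ j * b l)) -> u = 0].
Proof.
move=> At [D HD].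
pose spans m e (b : 'I_e -> S) := (forall l, A m (b l)) /\
  forall j y, A (m + j)%N y ->
    exists u : 'rV_e, idl A z (y - \sum_l u 0 l *: (t ^+ j * b l)).
pose P e := `[< exists m (b : 'I_e -> S), spans m e b >].
have exP : exists e, P e.
  (* A spanning family of [A D] works: beyond degree [D], modulo the ideal of [z], each element is
     [t] times one a degree lower. *)
  have [q [b [Ab Hb]]] := fA D; exists q; apply/asboolP; exists D, b; split=> //.
  elim=> [|j IHj] y Ay.
    rewrite addn0 in Ay; have [c Ey] := Hb y Ay; exists (\row_l c l).
    rewrite [X in _ - X](_ : _ = y) ?subrr; first exact: idl0.
    by rewrite [RHS]Ey; apply: eq_bigr => l _; rewrite mxE mul1r.
  rewrite addnS in Ay.
  have [|g [Ag ->]] := idl_homogeneous gA (extend_homogeneous At) Ay.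
    by apply: HD Ay; rewrite leqW // leq_addr.
  have [u Hu] := IHj _ (Ag None); exists u.
  rewrite sum_option /= -addrA; apply: idlD => //.
    exists (fun i => g (Some i)); split=> // i; exact: dsum_gsub (Ag _).
  have -> : \sum_l u 0 l *: (t ^+ j.+1 * b l) = t * \sum_l u 0 l *: (t ^+ j * b l).
    by rewrite mulr_sumr; apply: eq_bigr => l _; rewrite -scalerAr mulrA exprS.
  by rewrite mulrC -mulrBr; apply: idlM => //; apply: dsum_gsub At.
case: (ex_minnP exP) => e /asboolP[m [b [Ab b_span]]] mine.
exists m, e, b; split=> // j u Iu; apply/rowP => l0; rewrite mxE.
apply/eqP/negPn/negP => ul0.
case: e => [|e] in b u l0 Ab b_span mine Iu ul0 *; first by have := ltn_ord l0.
suff : P e by move=> /mine; rewrite ltnn.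
apply/asboolP; exists (j + m)%N, (fun l => t ^+ j * b (lift l0 l)); split.
  by move=> l; apply: gsubM => //; have := gsubX gA j At; rewrite mul1n.
move=> i y Ay; have [|c Hc] := b_span (j + i)%N y; first by rewrite addnCA addnA.
(* These coordinates arise by eliminating [b l0] through the relation [u], whose entry at [l0] is
   nonzero. *)
exists (\row_l (c 0 (lift l0 l) - c 0 l0 / u 0 l0 * u 0 (lift l0 l))).
have -> : y - \sum_l (\row_l (c 0 (lift l0 l) - c 0 l0 / u 0 l0 * u 0 (lift l0 l))) 0 l
      *: (t ^+ i * (t ^+ j * b (lift l0 l))) =
    (y - \sum_l c 0 l *: (t ^+ (j + i) * b l)) +
    (c 0 l0 / u 0 l0) *: (t ^+ i * \sum_l u 0 l *: (t ^+ j * b l)).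
  rewrite -addrA; congr (_ + _); rewrite mulr_sumr scaler_sumr.
  rewrite !(bigD1_ord l0) //= -scalerAr scalerA divfK // mulrA -exprD addnC.
  rewrite opprD addrACA addNr add0r -sumrN -sumrN -big_split; apply: eq_bigr => l _ /=.
  by rewrite mxE -scalerAr scalerA mulrA -exprD addnC -!scaleNr -scalerDl opprB addrC.
apply: idlD => //; apply: idlZ => //; apply: idlM => //.
by apply: (dsum_gsub gA (gsubX gA i At)).
Qed.

End PolynomialFamily.

Lemma image_ord_recr (r : nat) (U : Type) (F : 'I_r.+1 -> U) (z : 'I_r -> U) (t : U) :
  (forall j, F (widen_ord (leqnSn r) j) = z j) -> F ord_max = t ->
  [set F j | j in [set: 'I_r.+1]] = [set extend z t o | o in [set: option 'I_r]].
Proof.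
move=> Fz Ft; apply/seteqP; split=> y [].
  move=> j _ <-; case: (ltnP j r) => [ltj|lej].
    exists (Some (Ordinal ltj)) => //=; rewrite -Fz; congr F; exact: val_inj.
  exists None => //=; rewrite -Ft; congr F; apply: val_inj.
  by apply/eqP; rewrite eqn_leq lej -ltnS ltn_ord.
case=> [j|] _ <- /=; first by exists (widen_ord (leqnSn r) j).
by exists ord_max.
Qed.

(** * The diagonal subring as a graded subalgebra *)

Section Diagonal.
Variables (k : fieldType) (n : nat) (S : comAlgType k) (G : 'X_{1..n} -> set S).
Hypotheses (stdG : standard_graded G) (n_gt0 : (0 < n)%N).

Local Notation ones m := [multinom m | _ < n].

Let gG : graded_algebra G. Proof. by case: stdG. Qed.

(** Intersecting with [diag G] keeps the pieces inside the generated subalgebra, so that one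
    inclusion of [dsum_diag_part] holds by construction. *)
Definition diag_part m : set S := diag G `&` G (ones m).

Let G0 a : G a 0. Proof. by have [/set_mem] := graded_subspace gG a. Qed.

Let GP a c y z : G a y -> G a z -> G a (c *: y + z).
Proof.
move=> Gy Gz; have [_ Glin] := graded_subspace gG a.
by apply/set_mem/Glin; apply/mem_set.
Qed.

Let diagP c y z : diag G y -> diag G z -> diag G (c *: y + z).
Proof.
move=> Dy Dz; have [_ Dlin _] := gen_subalg_closed (G (ones 1%N)).
by apply/set_mem/Dlin; apply/mem_set.
Qed.

Let diagM y z : diag G y -> diag G z -> diag G (y * z).
Proof.
move=> Dy Dz; have [_ _ DM] := gen_subalg_closed (G (ones 1%N)).
by apply/set_mem/DM; apply/mem_set.
Qed.

Let diag1 : diag G 1.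
Proof. by have [/set_mem] := gen_subalg_closed (G (ones 1%N)). Qed.

Let diag0 : diag G 0.
Proof. by have := diagP (-1) diag1 diag1; rewrite scaleN1r addNr. Qed.

Let ones0 : ones 0%N = 0%MM.
Proof. by apply/mnmP => i; rewrite mnmE. Qed.

Let onesD i j : ones (i + j)%N = (ones i + ones j)%MM.
Proof. by apply/mnmP => l; rewrite mnmDE !mnmE. Qed.

Let ones_inj : injective (fun m => ones m).
Proof. by move=> i j /mnmP/(_ (Ordinal n_gt0)); rewrite !mnmE. Qed.

Lemma graded_diag_part : graded_subalgebra diag_part.
Proof.
have [_ EG0 _] := stdG.
split.
- by move=> m; split.
- by move=> m c y z [Dy Gy] [Dz Gz]; split; [apply: diagP | apply: GP].
- by split=> //; rewrite ones0 EG0; exists 1 => //; rewrite scale1r.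
- by move=> y [_]; rewrite ones0 EG0 => -[c _ <-]; exists c.
- move=> i j y z [Dy Gy] [Dz Gz]; split; first exact: diagM.
  by rewrite onesD; apply: (graded_mul gG).
move=> p Ap p1.
(* Directness is inherited from [G]: the coefficient of degree i is placed at the exponent
   (i,...,i), and i is read off at the first coordinate, which exists since n > 0. *)
pose f (a : 'X_{1..n}) := let i := a (Ordinal n_gt0) in if a == ones i then p`_i else 0.
have f_ones i : f (ones i) = p`_i by rewrite /f mnmE eqxx.
have Gf a : G a (f a).
  rewrite /f; case: eqP => [Ea|_]; last exact: G0.
  by have [_] := Ap (a (Ordinal n_gt0)); rewrite -Ea.
have f0 := graded_direct gG (s := [seq ones i | i <- iota 0 (size p)]) _ Gf.
apply/polyP => i; rewrite coef0; have [lei|lti] := leqP (size p) i.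
  by rewrite nth_default.
rewrite -f_ones; apply: f0.
- by rewrite map_inj_uniq ?iota_uniq.
- rewrite big_map -[RHS]p1 horner_coef.
  rewrite -(big_mkord xpredT (fun j => p`_j * 1 ^+ j)) /index_iota subn0.
  by apply: eq_bigr => j _; rewrite f_ones expr1n mulr1.
- by apply/mapP; exists i; rewrite // mem_iota.
Qed.

Lemma dsum_diag_part : dsum diag_part = diag G.
Proof.
apply/seteqP; split=> [_ [p [Ap ->]]|].
  rewrite horner_coef; elim/big_ind: _ => // [u v Du Dv|i _].
    by rewrite -[u]scale1r; apply: diagP.
  by rewrite expr1n mulr1; case: (Ap i).
apply: smallest_sub; first exact: dsum_subalg graded_diag_part.
move=> y Gy; apply: (dsum_gsub graded_diag_part (m := 1%N)); split=> //.
exact: sub_gen_smallest.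
Qed.

Lemma prod_diag_part (y : 'I_n -> S) :
  (forall i, G U_(i)%MM (y i)) -> diag_part 1 (\prod_i y i).
Proof.
have [_ EG0 _] := stdG.
move=> Gy; have Gprod r : G (\sum_(i <- r) U_(i))%MM (\prod_(i <- r) y i).
  elim: r => [|i r IHr]; last by rewrite !big_cons; apply: (graded_mul gG).
  by rewrite !big_nil EG0; exists 1 => //; rewrite scale1r.
have Gones : G (ones 1%N) (\prod_i y i).
  rewrite (_ : ones 1%N = (\sum_i U_(i))%MM) //; apply/mnmP => j.
  rewrite mnmE mnm_sumE (bigD1 j) //= mnm1E eqxx big1 // => i /negPf ij.
  by rewrite mnm1E ij.
by split=> //; apply: sub_gen_smallest.
Qed.

End Diagonal.

(** * The closed set of bad parameters *)

Theorem theorem5p2 (k : fieldType) (n : nat) (S : comAlgType k)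
    (G : 'X_{1..n} -> set S) (d : nat) (x w : 'M[S]_(n, d)) :
  infinite_set [set: k] ->
  standard_graded G ->
  krull_dim (diag_ring G) d ->
  (1 <= d)%N ->
  complete_reduction G x ->
  complete_reduction G w ->
  exists M : set 'rV[k]_d,
    [/\ zariski_closed M,
        M `<` [set: 'rV[k]_d] &
        forall v : 'rV[k]_d,
          ~ M v <->
          complete_reduction G
            (\matrix_(i < n, j < d)
               if (j.+1 < d)%N then x i j else \sum_(h < d) v 0 h *: w i h)].
Proof.
move=> kinf stdG _ d_gt0 crx crw.
(* Matrices without rows all coincide, so for n = 0 every [v] is good and [M] is empty, the zero
   locus of 1. *)
have [n0|n_gt0] := posnP n.
  subst n; exists set0; split.
  - exists [set 1]; apply/seteqP; split=> // v /(_ 1 erefl) /eqP.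
    by rewrite meval1 oner_eq0.
  - by split=> // /(_ 0); apply.
  - have Ex y : y = x by rewrite (flatmx0 y) (flatmx0 x).
    by move=> v; split=> [_|_ []]; rewrite (Ex (\matrix_(i, j) _)).
case: d => [//|r] in x w d_gt0 crx crw *.
have gA := graded_diag_part stdG n_gt0.
have EA := dsum_diag_part stdG n_gt0.
set A := diag_part G in gA EA.
pose X (y : 'M[S]_(n, r.+1)) j := \prod_i y i j.
pose z (j : 'I_r) := X x (widen_ord (leqnSn r) j).
have [[Gx mfx] [Gw mfw]] := (crx, crw).
have AX (y : 'M[S]_(n, r.+1)) :
    (forall i j, G U_(i)%MM (y i j)) -> forall j, A 1%N (X y j).
  by move=> Gy j; apply: prod_diag_part.
have Az j : A 1%N (z j) by apply: AX.
rewrite -EA in mfx mfw.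
have fA m : finite_span (A m) := finite_span_of_module_finite gA (AX _ Gx) m mfx.
(* Expanding the product of the n linear forms over all choices [f] of one index per row makes the
   last column product polynomial in [v]. *)
pose mu (f : {ffun 'I_n -> 'I_r.+1}) (v : 'rV[k]_r.+1) := \prod_i v 0 (f i).
pose omega (f : {ffun 'I_n -> 'I_r.+1}) := \prod_i w i (f i).
have mu_poly f : polyfun (mu f) by apply: polyfun_prod => i; apply: polyfun_coord.
have Aomega f : A 1%N (omega f) by apply: prod_diag_part.
pose a v := \sum_f mu f v *: omega f.
have Ea v : a v = \prod_i \sum_h v 0 h *: w i h.
  by rewrite bigA_distr_bigA; apply: eq_bigr => f _; rewrite scaler_prod.
pose good v := contains_high_degrees A (extend z (a v)).
have Aa v : A 1%N (a v) by apply: polynomial_family_homogeneous.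
have crE (v : 'rV[k]_r.+1) : complete_reduction G (\matrix_(i < n, j < r.+1)
    if (j.+1 < r.+1)%N then x i j else \sum_(h < r.+1) v 0 h *: w i h) <-> good v.
  set y := (\matrix_(_, _) _).
  have Gy i j : G U_(i)%MM (y i j).
    rewrite mxE; case: ifP => _ //.
    have [G0 Glin] := graded_subspace (let: And3 gG _ _ := stdG in gG) U_(i)%MM.
    elim/big_ind: _ => [|u1 u2 Gu1 Gu2|h _]; first exact/set_mem.
      by rewrite -[u1]scale1r; apply/set_mem/Glin; apply/mem_set.
    by rewrite -[_ *: _]addr0; apply/set_mem/Glin => //; apply/mem_set.
  have Ey : [set X y j | j in [set: 'I_r.+1]] =
      [set extend z (a v) o | o in [set: option 'I_r]].
    apply: image_ord_recr => [j|]; last rewrite Ea; apply: eq_bigr => i _.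
      by rewrite mxE /= ltnS ltn_ord.
    by rewrite mxE ltnn.
  have Aext := extend_homogeneous Az (Aa v).
  rewrite /complete_reduction -EA -[[set _ | j in _]]/[set X y j | j in [set: 'I_r.+1]] Ey.
  split=> [[_]|gv]; first exact: contains_high_degrees_of_module_finite.
  by split=> //; apply: module_finite_of_contains_high_degrees.
have good_open v0 : good v0 -> exists F,
    [/\ polyfun F, F v0 != 0 & forall v, F v != 0 -> good v].
  apply: (contains_high_degrees_open gA fA Az mu_poly Aomega (AX _ Gx)).
  exact: contains_high_degrees_of_module_finite (AX _ Gx) mfx.
have [v1 good_v1] : exists v, good v.
  (* Localize at the last column product of [x]; at the standard basis vectors, [a] takes the column
     products of [w] as values. *)
  have At := AX _ Gx ord_max.
  have [|m [e [b [Ab b_span b_free]]]] := exists_dehomogenization gA fA Az At.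
    have Aext := extend_homogeneous Az At.
    apply: contains_high_degrees_of_module_finite => //.
    by rewrite -(image_ord_recr (F := X x)).
  have Eaw h : a (delta_mx 0 h) = X w h.
    rewrite Ea; apply: eq_bigr => i _; rewrite (bigD1 h) //= mxE !eqxx scale1r.
    by rewrite big1 ?addr0 // => j /negPf jh; rewrite mxE eqxx jh scale0r.
  have hiw : contains_high_degrees A (fun h => a (delta_mx 0 h)).
    rewrite (_ : (fun h => _) = X w); last exact/funext.
    exact: contains_high_degrees_of_module_finite (AX _ Gw) mfw.
  have [v Hv] := exists_contains_high_degrees gA mu_poly Aomega At Ab
    b_span b_free kinf hiw.
  by exists v.
(* [M] is cut out by all polynomials whose nonvanishing forces [good]; by [good_open], each good [v]
   has such a polynomial nonzero at it. *)
pose I : set {mpoly k[r.+1]} :=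
  [set p : {mpoly k[r.+1]} | forall v : 'rV_r.+1, p.@[v 0] != 0 -> good v].
pose M := [set v : 'rV[k]_r.+1 | forall p : {mpoly k[r.+1]}, I p -> p.@[v 0] = 0].
have ME v : ~ M v <-> good v.
  split=> [nMv|/good_open[F [[p Fp] Fv0 FI]] Mv].
    apply: contrapT => bad; apply: nMv => p Ip; apply/eqP/negPn/negP => pv.
    exact: bad (Ip v pv).
  case/eqP: Fv0; rewrite Fp; apply: Mv => u; rewrite -Fp; exact: FI.
exists M; split; first by exists I.
- by split=> // /(_ v1) /= Mv1; have /ME := good_v1; apply; apply: Mv1.
- by move=> v; rewrite ME; split=> /crE.
Qed.
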